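(* Let $\mathscr{H}=\mathscr{H}_L\oplus\mathscr{H}_C\oplus\mathscr{H}_R$ be an orthogonal decomposition of a Hilbert space and, for $A\in\{L,C,R,LC,CR\}$, let $P_A$ be the orthogonal projection of $\mathscr{H}$ onto $\mathscr{H}_A$, where $\mathscr{H}_{LC}=\mathscr{H}_L\oplus\mathscr{H}_C$ and $\mathscr{H}_{CR}=\mathscr{H}_C\oplus\mathscr{H}_R$. A unitary operator $U$ on $\mathscr{H}$ admits a factorization $$U=(U_{LC}\oplus\mathbb{1}_{\mathscr{H}_R})(\mathbb{1}_{\mathscr{H}_L}\oplus U_{CR})$$ with $U_{LC}$ a unitary operator on $\mathscr{H}_{LC}$ and $U_{CR}$ a unitary operator on $\mathscr{H}_{CR}$ (an $\mathscr{H}_C$-overlapping factorization) if and only if $$P_RUP_L=0\quad\text{and}\quad \operatorname{rank}(P_{LC}UP_{CR})=\operatorname{rank}P_C .$$ Moreover, in this case the factorization is unique up to a unitary $U_C$ on $\mathscr{H}_C$: any other such factorization is given by $\hat U_{LC}=U_{LC}(\mathbb{1}_{\mathscr{H}_L}\oplus U_C)$ and $\hat U_{CR}=(U_C^\dagger\oplus\mathbb{1}_{\mathscr{H}_R})U_{CR}$ for some unitary $U_C$ on $\mathscr{H}_C$ (and every such pair is again an $\mathscr{H}_C$-overlapping factorization of $U$). Finally, if $\dim\mathscr{H}_L<\infty$ or $\dim\mathscr{H}_R<\infty$, the rank condition may be omitted, i.e. $P_RUP_L=0$ alone is equivalent to the existence of such a factorization.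
   Context: $\mathbb{1}_{\mathscr{K}}$ denotes the identity operator on a Hilbert space $\mathscr{K}$; direct sums of operators are taken with respect to the indicated orthogonal decompositions (e.g. $U_{LC}\oplus\mathbb{1}_{\mathscr{H}_R}$ acts as $U_{LC}$ on $\mathscr{H}_{LC}$ and as the identity on $\mathscr{H}_R$). *)

(* Defs.v *)
(* MathComp (+ mathcomp-reals for realType, mathcomp-real-closed for R[i]). *)
From HB Require Import structures.
From mathcomp Require Import all_boot all_order all_algebra.
From mathcomp Require Import reals.
From mathcomp.real_closed Require Import complex.

Set Implicit Arguments.
Unset Strict Implicit.
Unset Printing Implicit Defensive.

Import Order.TTheory GRing.Theory Num.Theory.
Local Open Scope ring_scope.
Local Open Scope complex_scope.

Section HilbertDefs.
Variables (R : realType) (H : lmodType R[i]).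
Variable ip : H -> H -> R[i].

(** Squared norm |x|^2 = <x,x> (a nonnegative real number). *)
Definition sqnorm (x : H) : R := complex.Re (ip x x).

(** Inner product axioms (linear in the first argument, conjugate symmetric,
    positive definite). *)
Definition inner_product : Prop :=
  [/\ (forall a x y z, ip (a *: x + y) z = a * ip x z + ip y z),
      (forall x y, ip y x = (ip x y)^*),
      (forall x, 0 <= ip x x) &
      (forall x, ip x x = 0 -> x = 0)].

(** Completeness w.r.t. the norm induced by [ip]. *)
Definition complete_ip : Prop :=
  forall u : nat -> H,
    (forall eps : R, 0 < eps -> exists N : nat, forall m n : nat,
        (N <= m)%N -> (N <= n)%N -> sqnorm (u m - u n) < eps) ->
    exists l : H, forall eps : R, 0 < eps -> exists N : nat, forall n : nat,
        (N <= n)%N -> sqnorm (u n - l) < eps.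

(** [H] with [ip] is a (complex) Hilbert space. *)
Definition hilbert_space : Prop := inner_product /\ complete_ip.

(** Subsets of [H] are predicates. *)
Definition subspace (S : H -> Prop) : Prop :=
  S 0 /\ forall a x y, S x -> S y -> S (a *: x + y).

Definition orth (S T : H -> Prop) : Prop :=
  forall x y, S x -> T y -> ip x y = 0.

(** [P] is the orthogonal projection of [H] onto [S]. *)
Definition orth_proj (S : H -> Prop) (P : H -> H) : Prop :=
  subspace S /\ forall x, S (P x) /\ forall y, S y -> ip (x - P x) y = 0.

(** The sum of two subsets. *)
Definition ssum (S T : H -> Prop) : H -> Prop :=
  fun z => exists x y, S x /\ T y /\ z = x + y.

Definition range (f : H -> H) : H -> Prop := fun y => exists x, f x = y.

(** Closure w.r.t. the norm topology. *)
Definition closure (S : H -> Prop) : H -> Prop :=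
  fun z => forall eps : R, 0 < eps -> exists x, S x /\ sqnorm (z - x) < eps.

Definition orthonormal (E : H -> Prop) : Prop :=
  forall e f, E e -> E f -> ip e f = (if e == f then 1 else 0).

(** [E] is an orthonormal basis of the closed linear span / closure of the
    subspace [S]: orthonormal, contained in the closure of [S], and maximal
    there (every vector orthogonal to [E] is orthogonal to [S]). *)
Definition onb_of (S : H -> Prop) (E : H -> Prop) : Prop :=
  [/\ orthonormal E,
      (forall e, E e -> closure S e) &
      (forall y, (forall e, E e -> ip y e = 0) -> forall x, S x -> ip y x = 0)].

(** Two subsets have the same cardinality. *)
Definition same_card (A B : H -> Prop) : Prop :=
  exists f : H -> H,
    [/\ (forall x, A x -> B (f x)),
        (forall x y, A x -> A y -> f x = f y -> x = y) &
        (forall z, B z -> exists2 x, A x & f x = z)].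

(** Equality of Hilbert dimensions (of the closures) of two subspaces. *)
Definition same_hdim (S T : H -> Prop) : Prop :=
  exists E F, [/\ onb_of S E, onb_of T F & same_card E F].

(** rank of an operator = (Hilbert) dimension of its range. *)
Definition same_rank (A B : H -> H) : Prop := same_hdim (range A) (range B).

(** Finite (algebraic) dimension of a subspace. *)
Definition fin_dim (S : H -> Prop) : Prop :=
  exists s : seq H, (forall v, v \in s -> S v) /\
    forall x, S x -> exists c : H -> R[i], x = \sum_(v <- s) c v *: v.

(** [V] (a map defined on all of [H], only its restriction matters) restricts
    to a unitary operator on the subspace [S]: linear on [S], maps [S] into
    [S], isometric (preserves [ip]) on [S] and surjective onto [S]. *)
Definition unitary_on (S : H -> Prop) (V : H -> H) : Prop :=
  [/\ (forall a x y, S x -> S y -> V (a *: x + y) = a *: V x + V y),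
      (forall x, S x -> S (V x)),
      (forall x y, S x -> S y -> ip (V x) (V y) = ip x y) &
      (forall z, S z -> exists2 x, S x & V x = z)].

(** [W] restricted to [S] is the adjoint of [V] restricted to [S]. *)
Definition adjoint_on (S : H -> Prop) (V W : H -> H) : Prop :=
  (forall x, S x -> S (W x)) /\
  forall x y, S x -> S y -> ip (V x) y = ip x (W y).

Definition unitary (V : H -> H) : Prop := unitary_on (fun _ => True) V.

End HilbertDefs.

(* Main.v *)
(* Global unitaries X = U_LC (+) 1 and Y = 1 (+) U_CR turn a factorization into U = X Y,
   where X fixes HR and Y fixes HL; given X, the factor Y = X^-1 U fixes HL as soon as X
   agrees with U on HL. When P_R U P_L = 0, the range of P_LC U P_CR is exactly the
   orthogonal complement of U HL in HLC, and X has to map HC unitarily onto it: the rank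
   condition says that such a unitary exists. If HL is finite dimensional, X is instead
   a finite product of Householder-type maps carrying a spanning list of HL to its image
   under U; the case of HR is the same argument for U^-1. The quotient X^-1 X' of two
   solutions fixes HL and HR, hence is a unitary on HC. *)
From mathcomp Require Import all_boot all_order all_algebra.
From mathcomp Require Import reals ring lra.
From mathcomp.real_closed Require Import complex.
From mathcomp Require boolp classical_sets.
Require Import Defs.

Set Implicit Arguments.
Unset Strict Implicit.
Unset Printing Implicit Defensive.

Import Order.TTheory GRing.Theory Num.Theory.
Local Open Scope ring_scope.
Local Open Scope complex_scope.

(** * Inner products *)

Section ComplexModulus.
Variable R : realType.

Definition sqmod (z : R[i]) : R := complex.Re z ^+ 2 + complex.Im z ^+ 2.

Lemma realcM (x y : R) : (x * y)%:C = x%:C * y%:C :> R[i].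
Proof. exact: rmorphM. Qed.

Lemma realcB (x y : R) : (x - y)%:C = x%:C - y%:C :> R[i].
Proof. exact: rmorphB. Qed.

Lemma realcV (x : R) : (x^-1)%:C = x%:C^-1 :> R[i].
Proof. exact: fmorphV. Qed.

Lemma conjCD (z w : R[i]) : conjc (z + w) = conjc z + conjc w.
Proof. exact: rmorphD. Qed.

Lemma conjCN (z : R[i]) : conjc (- z) = - conjc z.
Proof. exact: rmorphN. Qed.

Lemma conjCM (z w : R[i]) : conjc (z * w) = conjc z * conjc w.
Proof. exact: rmorphM. Qed.

Lemma conjCV (z : R[i]) : conjc (z^-1) = (conjc z)^-1.
Proof. exact: fmorphV. Qed.

Lemma sqmodE (z : R[i]) : (sqmod z)%:C = z * conjc z.
Proof.
case: z => a b; apply/eqP; rewrite eq_complex /sqmod /=.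
by apply/andP; split; apply/eqP; ring.
Qed.

Lemma sqmod_ge0 z : 0 <= sqmod z.
Proof. by rewrite addr_ge0 ?sqr_ge0. Qed.

Lemma sqmod_eq0 z : sqmod z = 0 -> z = 0.
Proof.
case: z => a b /eqP; rewrite paddr_eq0 ?sqr_ge0 //= !sqrf_eq0.
by case/andP=> /eqP -> /eqP ->.
Qed.

(** The gap between the two sides is [sqmod (z - w)]. This replaces the triangle inequality, so that
    all estimates stay with squares. *)
Lemma sqmodD z w : sqmod (z + w) <= 2 * sqmod z + 2 * sqmod w.
Proof.
case: z w => a b [c d]; rewrite /sqmod /= -subr_ge0 (_ : _ - _ = (a - c) ^+ 2 + (b - d) ^+ 2);
  [by rewrite addr_ge0 ?sqr_ge0 | ring].
Qed.

Lemma sqmodN z : sqmod (- z) = sqmod z.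
Proof. by case: z => a b; rewrite /sqmod /= !sqrrN. Qed.

(** Limit arguments end here. For positive [C], the choice [eps = sqmod z / (2 * C)] bounds
    [sqmod z] by half of itself. *)
Lemma sqmod_small C z :
  (forall eps : R, 0 < eps -> sqmod z <= eps * C) -> z = 0.
Proof.
move=> small; apply: sqmod_eq0; apply/eqP; rewrite eq_le sqmod_ge0 andbT.
rewrite leNgt; apply/negP => z_gt0.
have [C_le0|C_gt0] := leP C 0.
  have := small 1 ltr01; rewrite mul1r => /le_trans /(_ C_le0).
  by rewrite leNgt z_gt0.
have := small (sqmod z / (2 * C)) (divr_gt0 z_gt0 (mulr_gt0 (ltr0Sn _ 1) C_gt0)).
rewrite (_ : _ * C = sqmod z / 2); last by field; rewrite gt_eqF.
by lra.
Qed.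

End ComplexModulus.

Section InnerProduct.
Variables (R : realType) (H : lmodType R[i]) (ip : H -> H -> R[i]).
Hypothesis ipH : inner_product ip.

Lemma ipC x y : ip y x = conjc (ip x y).
Proof. by case: ipH. Qed.

Lemma ipDl x y z : ip (x + y) z = ip x z + ip y z.
Proof. by case: ipH => /(_ 1 x y z); rewrite scale1r mul1r. Qed.

Lemma ip0l z : ip 0 z = 0.
Proof. by apply: (addIr (ip 0 z)); rewrite -ipDl !add0r. Qed.

Lemma ipZl a x z : ip (a *: x) z = a * ip x z.
Proof. by case: ipH => /(_ a x 0 z); rewrite addr0 ip0l addr0. Qed.

Lemma ipNl x z : ip (- x) z = - ip x z.
Proof. by rewrite -scaleN1r ipZl mulN1r. Qed.

Lemma ipBl x y z : ip (x - y) z = ip x z - ip y z.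
Proof. by rewrite ipDl ipNl. Qed.

Lemma ip0r z : ip z 0 = 0.
Proof. by rewrite ipC ip0l rmorph0. Qed.

Lemma ipDr x y z : ip z (x + y) = ip z x + ip z y.
Proof. by rewrite ipC ipDl conjCD -!ipC. Qed.

Lemma ipZr a x z : ip z (a *: x) = conjc a * ip z x.
Proof. by rewrite ipC ipZl conjCM -!ipC. Qed.

Lemma ipNr x z : ip z (- x) = - ip z x.
Proof. by rewrite ipC ipNl conjCN -!ipC. Qed.

Lemma ipBr x y z : ip z (x - y) = ip z x - ip z y.
Proof. by rewrite ipDr ipNr. Qed.

Lemma ip_sym0 x y : ip x y = 0 -> ip y x = 0.
Proof. by move=> xy0; rewrite ipC xy0 rmorph0. Qed.

Lemma ip_eq0 x : ip x x = 0 -> x = 0.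
Proof. by case: ipH => _ _ _; apply. Qed.

Lemma ip_ext x y : (forall z, ip x z = ip y z) -> x = y.
Proof.
by move=> xy; apply/eqP; rewrite -subr_eq0; apply/eqP/ip_eq0; rewrite ipBl xy subrr.
Qed.

Lemma ipxxE x : ip x x = (sqnorm ip x)%:C.
Proof.
case: ipH => _ _ /(_ x) ge0 _; move: ge0; rewrite /sqnorm.
by case: (ip x x) => a b; rewrite lecE /= => /andP[/eqP -> _].
Qed.

Lemma sqnorm_ge0 x : 0 <= sqnorm ip x.
Proof. by case: ipH => _ _ /(_ x) + _; rewrite lecE => /andP[]. Qed.

Lemma sqnorm_eq0 x : sqnorm ip x = 0 -> x = 0.
Proof. by move=> x0; apply: ip_eq0; rewrite ipxxE x0. Qed.

Lemma sqnormN x : sqnorm ip (- x) = sqnorm ip x.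
Proof. by rewrite /sqnorm ipNl ipNr opprK. Qed.

Lemma sqnormB x y : sqnorm ip (x - y) = sqnorm ip (y - x).
Proof. by rewrite -sqnormN opprB. Qed.

Lemma parallelogram x y :
  sqnorm ip (x + y) + sqnorm ip (x - y) = 2 * sqnorm ip x + 2 * sqnorm ip y.
Proof.
rewrite /sqnorm !(ipDl, ipDr, ipNl, ipNr).
by case: (ip x x) (ip x y) (ip y x) (ip y y) => ? ? [? ?] [? ?] [? ?] /=; ring.
Qed.

Lemma sqnormD x y : sqnorm ip (x + y) <= 2 * sqnorm ip x + 2 * sqnorm ip y.
Proof. by rewrite -parallelogram lerDl sqnorm_ge0. Qed.

Lemma sqnormZ a x : sqnorm ip (a *: x) = sqmod a * sqnorm ip x.
Proof.
apply: (@complexI R); rewrite -ipxxE ipZl ipZr ipxxE realcM sqmodE; ring.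
Qed.

Lemma pythagoras x y : ip x y = 0 ->
  sqnorm ip (x + y) = sqnorm ip x + sqnorm ip y.
Proof.
by move=> xy0; rewrite /sqnorm !(ipDl, ipDr) xy0 (ip_sym0 xy0) addr0 add0r raddfD.
Qed.

(** The subtracted vector is the projection of [x] onto the line of [y]. Nonnegativity of the left
    side is Cauchy-Schwarz; the decrease on the right drives the variational step of the projection
    theorem. *)
Lemma sqnorm_line x y : y != 0 ->
  sqnorm ip (x - (ip x y / ip y y) *: y)
  = sqnorm ip x - sqmod (ip x y) / sqnorm ip y.
Proof.
move=> y_neq0; have Ny : sqnorm ip y != 0.
  by apply: contra y_neq0 => /eqP/sqnorm_eq0 ->.
have NyC : (sqnorm ip y)%:C != 0 :> R[i] by rewrite eq_complex /= eqxx andbT.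
apply: (@complexI R); rewrite -ipxxE !(ipBl, ipBr, ipZl, ipZr).
rewrite realcB realcM realcV sqmodE -ipxxE -[(sqnorm ip y)%:C]ipxxE.
rewrite conjCM conjCV -!ipC.
by field; rewrite ipxxE.
Qed.

Lemma cauchy_schwarz x y : sqmod (ip x y) <= sqnorm ip x * sqnorm ip y.
Proof.
have [->|y_neq0] := eqVneq y 0.
  by rewrite ip0r /sqmod /= expr0n addr0 mulr_ge0 ?sqnorm_ge0.
have Ny : 0 < sqnorm ip y.
  by rewrite lt_neqAle sqnorm_ge0 andbT; apply: contra y_neq0 => /eqP/esym/sqnorm_eq0 ->.
rewrite -ler_pdivrMr // -subr_ge0 -sqnorm_line //; exact: sqnorm_ge0.
Qed.

End InnerProduct.

(** * Projections *)

Section Subspaces.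
Variables (R : realType) (H : lmodType R[i]) (ip : H -> H -> R[i]).
Hypothesis ipH : inner_product ip.
Local Notation subspace := (@subspace R H).

Lemma subspaceD S x y : subspace S -> S x -> S y -> S (x + y).
Proof. by move=> [_ lin] Sx Sy; rewrite -[x]scale1r; apply: lin. Qed.

Lemma subspaceZ S a x : subspace S -> S x -> S (a *: x).
Proof. by move=> [S0 lin] Sx; rewrite -[_ *: _]addr0; apply: lin. Qed.

Lemma subspaceB S x y : subspace S -> S x -> S y -> S (x - y).
Proof.
by move=> sS Sx Sy; apply: subspaceD => //; rewrite -scaleN1r; apply: subspaceZ.
Qed.

Lemma inv_succ_lt (eps : R) : 0 < eps ->
  exists N : nat, forall n, (N <= n)%N -> n.+1%:R^-1 < eps.
Proof.
move=> eps_gt0; exists (Num.bound eps^-1) => n leNn.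
have iv_gt0 : 0 < eps^-1 by rewrite invr_gt0.
rewrite -[eps]invrK ltf_pV2 ?posrE ?ltr0Sn //.
apply: lt_trans (archi_boundP (ltW iv_gt0)) _.
by rewrite ltr_nat ltnS.
Qed.

Lemma complete_rate (u : nat -> H) : complete_ip ip ->
  (forall m n, sqnorm ip (u m - u n) <= 2 * (m.+1%:R^-1 + n.+1%:R^-1)) ->
  exists l, forall eps : R, 0 < eps -> exists N : nat, forall n : nat,
    (N <= n)%N -> sqnorm ip (u n - l) < eps.
Proof.
move=> complete rate; apply: complete => eps eps_gt0.
(* The threshold is [eps / 4], as the rate bound doubles a sum of two such terms. *)
have [N ltN] := inv_succ_lt (divr_gt0 eps_gt0 (ltr0Sn R 3)).
exists N => m n /ltN ltm /ltN ltn; apply: le_lt_trans (rate m n) _.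
move: m.+1%:R^-1 n.+1%:R^-1 ltm ltn => a b; lra.
Qed.

(* Minimize the distance to [x] over [D]: the parallelogram law makes a minimizing
   sequence Cauchy. *)
Lemma projection_theorem D x : complete_ip ip -> subspace D ->
  (forall z, closure ip D z -> D z) ->
  exists d, D d /\ forall y, D y -> ip (x - d) y = 0.
Proof.
move=> complete sD clD; have [D0 _] := sD.
pose E : classical_sets.set R := fun r => exists2 d, D d & r = sqnorm ip (x - d).
have lbE : classical_sets.has_lbound E.
  by exists 0 => r [d _ ->]; apply: sqnorm_ge0.
have infE d : D d -> inf E <= sqnorm ip (x - d).
  by move=> Dd; apply: (ge_inf lbE); exists d.
have hasE : classical_sets.has_inf E by split => //; exists (sqnorm ip (x - 0)), 0.
have approx n : exists d, D d /\ sqnorm ip (x - d) < inf E + n.+1%:R^-1.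
  have [|r [d Dd ->] ltr] := @inf_adherent R E n.+1%:R^-1 _ hasE.
    by rewrite invr_gt0 ltr0Sn.
  by exists d.
have [u uP] := boolp.choice approx.
have Du n : D (u n) by case: (uP n).
have ltu n : sqnorm ip (x - u n) < inf E + n.+1%:R^-1 by case: (uP n).
have [|l lP] := @complete_rate u complete.
  move=> m n; have := parallelogram ipH (x - u m) (x - u n).
  have -> : x - u m - (x - u n) = - (u m - u n).
    by rewrite !opprB addrC addrA subrK.
  rewrite (sqnormN ipH).
  (* The midpoint of [u m] and [u n] lies in [D], so this vector has squared norm at least
     [4 * inf E]. *)
  have -> : x - u m + (x - u n) = (2 : R[i]) *: (x - (2 : R[i])^-1 *: (u m + u n)).
    rewrite scalerBr scalerA divff ?scale1r ?pnatr_eq0 //.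
    by rewrite scaler_nat mulr2n opprD addrACA.
  rewrite (sqnormZ ipH).
  have -> : sqmod (2 : R[i]) = 4 by rewrite /sqmod /= addr0; ring.
  have := infE ((2 : R[i])^-1 *: (u m + u n)).
  move/(_ (subspaceZ _ sD (subspaceD sD (Du m) (Du n)))).
  move: (ltu m) (ltu n); move: m.+1%:R^-1 n.+1%:R^-1 => a b; lra.
have Dl : D l.
  apply: clD => eps /lP [N /(_ N (leqnn N)) ltN]; exists (u N); split=> //.
  by rewrite (sqnormB ipH).
exists l; split=> // y Dy.
(* Splitting [x - l] through [u n] gives two terms, each at most [eps * sqnorm ip y] and each
   doubled by [sqmodD]. *)
apply: (@sqmod_small R (4 * sqnorm ip y)) => eps eps_gt0.
have [N1 lt1] := inv_succ_lt eps_gt0; have [N2 lt2] := lP _ eps_gt0.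
pose n := maxn N1 N2; have {lt1}lt1 := lt1 n (leq_maxl _ _).
have {lt2}lt2 := lt2 n (leq_maxr _ _).
have -> : x - l = (x - u n) + (u n - l) by rewrite addrA subrK.
rewrite (ipDl ipH); apply: le_trans (sqmodD _ _) _.
have := cauchy_schwarz ipH (u n - l) y.
have y_ge0 := sqnorm_ge0 ipH y.
have : sqmod (ip (x - u n) y) <= eps * sqnorm ip y.
  have [->|y_neq0] := eqVneq y 0.
    by rewrite (ip0r ipH) /sqmod /= expr0n addr0 mulr_ge0 ?sqnorm_ge0 // ltW.
  have y_gt0 : 0 < sqnorm ip y.
    rewrite lt_neqAle y_ge0 andbT.
    by apply: contra y_neq0 => /eqP/esym/(sqnorm_eq0 ipH) ->.
  rewrite -ler_pdivrMr //.
  set a := ip (x - u n) y / ip y y.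
  (* The best move along [y] lowers the squared distance by [sqmod (ip (x - u n) y) / sqnorm ip y],
     but [u n] is already within [eps] of the infimum. *)
  have := infE (u n + a *: y) (subspaceD sD (Du n) (subspaceZ _ sD Dy)).
  rewrite opprD addrA (sqnorm_line ipH) //.
  by move: (_ / sqnorm ip y) n.+1%:R^-1 (ltu n) lt1 => q c; lra.
have : sqnorm ip (u n - l) * sqnorm ip y <= eps * sqnorm ip y.
  by rewrite ler_wpM2r // ltW.
lra.
Qed.

(** Continuity of the inner product, phrased for pairs so that the equation defines a closed
    subspace of the product of [H] with itself. *)
Lemma ip_closed x y a b :
  (forall eps : R, 0 < eps -> exists x' y', ip x' a = ip y' b /\
     sqnorm ip (x - x') < eps /\ sqnorm ip (y - y') < eps) ->
  ip x a = ip y b.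
Proof.
move=> approx; apply/eqP; rewrite -subr_eq0; apply/eqP.
apply: (@sqmod_small R (2 * sqnorm ip a + 2 * sqnorm ip b)) => eps eps_gt0.
have [x' [y' [xy' [ltx lty]]]] := approx _ eps_gt0.
have -> : ip x a - ip y b = ip (x - x') a + - ip (y - y') b.
  by rewrite !(ipBl ipH) xy' opprB addrA subrK.
apply: le_trans (sqmodD _ _) _; rewrite sqmodN.
have := cauchy_schwarz ipH (x - x') a; have := cauchy_schwarz ipH (y - y') b.
have : sqnorm ip (x - x') * sqnorm ip a <= eps * sqnorm ip a.
  by rewrite ler_wpM2r ?sqnorm_ge0 // ltW.
have : sqnorm ip (y - y') * sqnorm ip b <= eps * sqnorm ip b.
  by rewrite ler_wpM2r ?sqnorm_ge0 // ltW.
lra.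
Qed.

End Subspaces.

Section OrthogonalProjection.
Variables (R : realType) (H : lmodType R[i]) (ip : H -> H -> R[i]).
Hypothesis ipH : inner_product ip.
Variables (S : H -> Prop) (P : H -> H).
Hypothesis pS : orth_proj ip S P.

Lemma proj_sub : subspace S. Proof. by case: pS. Qed.

Lemma proj_in x : S (P x). Proof. by case: pS => _ /(_ x) []. Qed.

Lemma proj_compl x y : S y -> ip (x - P x) y = 0.
Proof. by case: pS => _ /(_ x) [_]; apply. Qed.

Lemma proj_ip x y : S y -> ip (P x) y = ip x y.
Proof. by move=> Sy; apply/esym/eqP; rewrite -subr_eq0 -(ipBl ipH) proj_compl. Qed.

Lemma proj_unique x y : S y -> (forall z, S z -> ip x z = ip y z) -> P x = y.
Proof.
move=> Sy xy; apply/eqP; rewrite -subr_eq0; apply/eqP/(ip_eq0 ipH).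
have Sd : S (P x - y) by apply: subspaceB proj_sub _ Sy; apply: proj_in.
by rewrite {1}(ipBl ipH) proj_ip // xy // subrr.
Qed.

Lemma proj_id x : S x -> P x = x.
Proof. by move=> Sx; apply: proj_unique. Qed.

Lemma proj_eq0_ip x y : P x = 0 -> S y -> ip x y = 0.
Proof. by move=> Px Sy; rewrite -proj_ip // Px (ip0l ipH). Qed.

Lemma projB x y : P (x - y) = P x - P y.
Proof.
apply: proj_unique => [|z Sz]; first by apply: subspaceB proj_sub _ _; apply: proj_in.
by rewrite !(ipBl ipH) !proj_ip.
Qed.

Lemma projD x y : P (x + y) = P x + P y.
Proof.
apply: proj_unique => [|z Sz]; first by apply: subspaceD proj_sub _ _; apply: proj_in.
by rewrite !(ipDl ipH) !proj_ip.
Qed.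

Lemma projZ a x : P (a *: x) = a *: P x.
Proof.
apply: proj_unique => [|z Sz]; first by apply: subspaceZ proj_sub _; apply: proj_in.
by rewrite !(ipZl ipH) !proj_ip.
Qed.

Lemma proj_projC x : P (x - P x) = 0.
Proof. by rewrite projB (proj_id (proj_in _)) subrr. Qed.

(** By Pythagoras no point of [S] is closer to [z] than [P z]; taking [sqnorm ip (z - P z)] itself
    as [eps] forces [z = P z]. *)
Lemma proj_closed z : closure ip S z -> S z.
Proof.
move=> clz; suff /eqP: sqnorm ip (z - P z) = 0.
  by move/eqP/(sqnorm_eq0 ipH)/eqP; rewrite subr_eq0 => /eqP ->; apply: proj_in.
apply/eqP; rewrite eq_le sqnorm_ge0 // andbT leNgt; apply/negP => /clz [x [Sx]].
have -> : z - x = (z - P z) + (P z - x) by rewrite addrA subrK.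
rewrite (pythagoras ipH); last first.
  by apply: proj_compl; apply: subspaceB proj_sub _ Sx; apply: proj_in.
by apply/negP; rewrite -leNgt lerDl sqnorm_ge0.
Qed.

End OrthogonalProjection.

(** * Unitary operators *)

Section Unitary.
Variables (R : realType) (H : lmodType R[i]) (ip : H -> H -> R[i]).
Hypothesis ipH : inner_product ip.
Local Notation subspace := (@subspace R H).

Lemma ip_orthD x y x' y' : ip x y' = 0 -> ip y x' = 0 ->
  ip (x + y) (x' + y') = ip x x' + ip y y'.
Proof.
by move=> xy' yx'; rewrite (ipDl ipH) !(ipDr ipH) xy' yx' addr0 add0r.
Qed.

(** Linearity is automatic: the defect [V (a *: x + y) - (a *: V x + V y)] is orthogonal to every
    value of [V], and by surjectivity it is such a value. *)
Lemma isometry_onto_unitary_on S V : subspace S ->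
  (forall x, S x -> S (V x)) ->
  (forall x y, S x -> S y -> ip (V x) (V y) = ip x y) ->
  (forall z, S z -> exists2 x, S x & V x = z) -> unitary_on ip S V.
Proof.
move=> sS SV isoV ontoV; split=> // a x y Sx Sy.
have Sz : S (a *: x + y) by case: sS => _; apply.
have Sd : S (V (a *: x + y) - (a *: V x + V y)).
  by apply: subspaceB; last (case: sS => _; apply); auto.
apply/eqP; rewrite -subr_eq0; apply/eqP/(ip_eq0 ipH).
have [w Sw {2}<-] := ontoV _ Sd.
by rewrite (ipBl ipH) (ipDl ipH) (ipZl ipH) !isoV // (ipDl ipH) (ipZl ipH) subrr.
Qed.

Lemma isometry_onto_unitary V :
  (forall x y, ip (V x) (V y) = ip x y) ->
  (forall z, exists x, V x = z) -> unitary ip V.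
Proof.
move=> isoV ontoV; apply: isometry_onto_unitary_on => // z _.
by have [x <-] := ontoV z; exists x.
Qed.

Lemma unitary_ip V x y : unitary ip V -> ip (V x) (V y) = ip x y.
Proof. by case=> _ _ isoV _; apply: isoV. Qed.

Lemma unitaryD V x y : unitary ip V -> V (x + y) = V x + V y.
Proof. by case=> linV _ _ _; have := linV 1 x y I I; rewrite !scale1r. Qed.

Lemma unitaryZ V a x : unitary ip V -> V (a *: x) = a *: V x.
Proof.
move=> uV; have [linV _ _ _] := uV; have V0 : V 0 = 0.
  by have := unitaryD 0 0 uV; rewrite addr0 => /esym; rewrite -[RHS]addr0 => /addrI.
by have := linV a x 0 I I; rewrite addr0 V0 addr0.
Qed.

Lemma unitary_on0 S V : subspace S -> unitary_on ip S V -> V 0 = 0.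
Proof.
move=> [S0 _] [linV _ _ _]; have := linV 1 0 0 S0 S0.
by rewrite !scale1r addr0 => /esym; rewrite -[RHS]addr0 => /addrI.
Qed.

Lemma unitary0 V : unitary ip V -> V 0 = 0.
Proof. exact: unitary_on0. Qed.

Lemma unitary_sum V (I : Type) (s : seq I) (c : I -> R[i]) (v : I -> H) :
  unitary ip V -> V (\sum_(i <- s) c i *: v i) = \sum_(i <- s) c i *: V (v i).
Proof.
move=> uV; elim: s => [|i s IHs]; first by rewrite !big_nil unitary0.
by rewrite !big_cons (unitaryD _ _ uV) (unitaryZ _ _ uV) IHs.
Qed.

Lemma unitary_inverse V : unitary ip V ->
  exists Vi, [/\ unitary ip Vi, cancel V Vi & cancel Vi V].
Proof.
move=> uV; have [_ _ _ ontoV] := uV.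
have [|Vi VK] := @boolp.choice H H (fun z x => V x = z).
  by move=> z; have [x _ <-] := ontoV z I; exists x.
have ViK : cancel V Vi.
  by move=> x; apply: (ip_ext ipH) => y; rewrite -(unitary_ip _ _ uV) VK unitary_ip.
exists Vi; split=> //; apply: isometry_onto_unitary => [x y|z].
  by rewrite -(unitary_ip _ _ uV) !VK.
by exists (V z).
Qed.

Lemma unitary_comp V W : unitary ip V -> unitary ip W -> unitary ip (V \o W).
Proof.
move=> uV uW; apply: isometry_onto_unitary => [x y|z] /=.
  by rewrite !unitary_ip.
have [Vi [_ _ ViK]] := unitary_inverse uV.
have [Wi [_ _ WiK]] := unitary_inverse uW.
by exists (Wi (Vi z)); rewrite WiK ViK.
Qed.

(** The direct sum of [V] with the identity on the orthogonal complement. Only [P] is involved, so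
    one definition serves [LC], [CR] and [C]. *)
Definition extend (P V : H -> H) x := V (P x) + (x - P x).

Section Extend.
Variables (S : H -> Prop) (P : H -> H).
Hypothesis pS : orth_proj ip S P.

Lemma extend_unitary V : unitary_on ip S V -> unitary ip (extend P V).
Proof.
move=> [_ SV isoV ontoV]; have SP := proj_in pS.
apply: isometry_onto_unitary => [x y|z].
  have perp u v : S u -> ip (v - P v) u = 0 by apply: (proj_compl pS).
  have perp' u v : S u -> ip u (v - P v) = 0 by move/perp/(ip_sym0 ipH).
  rewrite /extend (ip_orthD (perp' _ _ (SV _ (SP x))) (perp _ _ (SV _ (SP y)))) isoV //.
  by rewrite -(ip_orthD (perp' _ _ (SP x)) (perp _ _ (SP y))) ![P _ + _]addrC !subrK.
have [s Ss Vs] := ontoV _ (SP z).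
exists (s + (z - P z)); rewrite /extend.
have -> : P (s + (z - P z)) = s.
  by rewrite (projD ipH pS) (proj_id ipH pS Ss) (proj_projC ipH pS) addr0.
by rewrite Vs addrAC subrr add0r addrC subrK.
Qed.

Lemma extend_fix V x : unitary_on ip S V -> P x = 0 -> extend P V x = x.
Proof.
by move=> uV Px; rewrite /extend Px (unitary_on0 (proj_sub pS) uV) add0r subr0.
Qed.

Lemma extend_in V x : S x -> extend P V x = V x.
Proof. by move=> Sx; rewrite /extend (proj_id ipH pS Sx) subrr addr0. Qed.

(** The component [t] of [X x] orthogonal to [S] is fixed by [X], so its inner product with [X x]
    equals that with [x], which is zero. *)
Lemma unitary_preserves X : unitary ip X -> (forall x, P x = 0 -> X x = x) ->
  forall x, S x -> S (X x).
Proof.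
move=> uX fixX x Sx; have Pt := proj_projC ipH pS (X x).
set t := X x - _ in Pt; suff t0 : t = 0.
  by move/eqP: t0; rewrite subr_eq0 => /eqP ->; apply: (proj_in pS).
have SP := proj_in pS (X x).
apply: (ip_eq0 ipH); rewrite {1}/t (ipBl ipH) -{1}(fixX _ Pt) unitary_ip //.
rewrite !(ip_sym0 ipH (proj_eq0_ip ipH pS Pt _)) ?subrr //.
Qed.

Lemma restrict_unitary X : unitary ip X -> (forall x, P x = 0 -> X x = x) ->
  unitary_on ip S X.
Proof.
move=> uX fixX; apply: isometry_onto_unitary_on; first exact: proj_sub pS.
- exact: unitary_preserves.
- by move=> x y _ _; apply: unitary_ip.
move=> z Sz; have [Xi [uXi XK XiK]] := unitary_inverse uX.
exists (Xi z); last exact: XiK.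
(* The inverse fixes the same complement, hence preserves [S] as well. *)
by apply: unitary_preserves Sz => // x Px; rewrite -{1}(fixX _ Px) XK.
Qed.

Lemma extend_restrict X x : unitary ip X -> (forall x, P x = 0 -> X x = x) ->
  extend P X x = X x.
Proof.
move=> uX fixX; rewrite /extend -(fixX _ (proj_projC ipH pS x)).
by rewrite -(unitaryD _ _ uX) addrC subrK.
Qed.

Lemma eq_unitary_on V W : subspace S -> unitary_on ip S V ->
  (forall x, S x -> W x = V x) -> unitary_on ip S W.
Proof.
move=> sS [_ SV isoV ontoV] WV; apply: isometry_onto_unitary_on => //.
- by move=> x Sx; rewrite WV //; apply: SV.
- by move=> x y Sx Sy; rewrite !WV // isoV.
by move=> z /ontoV [x Sx <-]; exists x; rewrite ?WV.
Qed.

End Extend.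

(* [T x = x - <x,w>/<a,w> w] with [w = a - b]; the equality of
   norms gives [<w,w> = 2 Re <a,w>], which makes it unitary. *)
Lemma reflection a b : ip a a = ip b b ->
  exists T, [/\ unitary ip T, T a = b & forall x, ip x (a - b) = 0 -> T x = x].
Proof.
move=> ab; have [->|neq_ab] := eqVneq a b.
  exists id; split=> //; apply: isometry_onto_unitary => // z; by exists z.
have [w wE] : exists w, w = a - b by exists (a - b).
rewrite -wE; have [z zE] : exists z, z = ip a w by exists (ip a w).
have zz : z + conjc z = ip w w.
  rewrite zE -(ipC ipH) wE !(ipBl ipH, ipBr ipH) -ab; ring.
have ww_neq0 : ip w w != 0.
  by apply: contra neq_ab => /eqP/(ip_eq0 ipH)/eqP; rewrite wE subr_eq0.
have z_neq0 : z != 0.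
  by apply: contra ww_neq0 => /eqP z0; rewrite -zz z0 conjc0 addr0.
have zc_neq0 : conjc z != 0 by rewrite conjc_eq0.
pose T x := x - (ip x w / z) *: w.
exists T; split.
- apply: isometry_onto_unitary => [x y|y].
    rewrite /T !(ipBl ipH, ipBr ipH, ipZl ipH, ipZr ipH) conjCM conjCV -!(ipC ipH) -zz.
    by field; rewrite z_neq0 zc_neq0.
  (* The preimage is the adjoint of [T] at [y]: the same formula with [conjc z] for [z]. *)
  exists (y - (ip y w / conjc z) *: w).
  have c0 : ip y w / conjc z + (ip y w - ip y w / conjc z * (z + conjc z)) / z = 0.
    by field; rewrite z_neq0 zc_neq0.
  by rewrite /T (ipBl ipH) (ipZl ipH) -zz -addrA -opprD -scalerDl c0 scale0r subr0.
- by rewrite /T -zE divff // scale1r wE subKr.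
by move=> x xw; rewrite /T xw mul0r scale0r subr0.
Qed.

(* Householder: correct the values on the list one vector at a time; each reflection
   vector [X v - U v] is orthogonal to the values already corrected. *)
Lemma finite_unitary_extension U (s : seq H) : unitary ip U ->
  exists X, [/\ unitary ip X, (forall v, v \in s -> X v = U v) &
    forall r, (forall v, v \in s -> ip r v = 0 /\ ip r (U v) = 0) -> X r = r].
Proof.
move=> uU; elim: s => [|v s [X [uX XU fixX]]].
  exists id; split=> //; apply: isometry_onto_unitary => // z; by exists z.
have [|T [uT Ta fixT]] := @reflection (X v) (U v); first by rewrite !unitary_ip.
exists (T \o X); split; first exact: unitary_comp.
  move=> x; rewrite inE => /predU1P[-> //|xs] /=.
  rewrite fixT XU // (ipBr ipH) -{1}XU // !unitary_ip // subrr //.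
move=> r rs /=; have Xr : X r = r.
  by apply: fixX => x xs; apply: rs; rewrite inE xs orbT.
have [rv rUv] := rs v (mem_head _ _).
by rewrite Xr fixT // (ipBr ipH) rUv subr0 -{1}Xr unitary_ip.
Qed.

End Unitary.

(** * Orthonormal bases *)

Section HilbertDimension.
Variables (R : realType) (H : lmodType R[i]) (ip : H -> H -> R[i]).
Hypothesis hilH : hilbert_space ip.
Local Notation subspace := (@subspace R H).

Let ipH : inner_product ip. Proof. by case: hilH. Qed.

(** A closed linear relation rather than a map: the isometry is given on basis vectors only, and its
    domain is known to be everything only at the end. *)
Definition closed_graph (G : H -> H -> Prop) : Prop :=
  [/\ G 0 0,
      (forall a x y x' y', G x y -> G x' y' -> G (a *: x + x') (a *: y + y')) &
      (forall x y, (forall eps : R, 0 < eps -> exists x' y', G x' y' /\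
         sqnorm ip (x - x') < eps /\ sqnorm ip (y - y') < eps) -> G x y)].

Definition isometric_graph (G : H -> H -> Prop) : Prop :=
  forall x y x' y', G x y -> G x' y' -> ip x x' = ip y y'.

Lemma closed_graph_flip G : closed_graph G -> closed_graph (fun x y => G y x).
Proof.
move=> [G0 Glin Gcl]; split=> // [a x y x' y'|x y approx]; first exact: Glin.
by apply: Gcl => eps /approx [x' [y' [? []]]]; exists y', x'.
Qed.

(** The domain of [G] is closed, since isometry turns a convergent sequence of first entries into a
    Cauchy sequence of second entries. The part of [x] orthogonal to the domain is orthogonal to
    [F], which is total in [T], so it vanishes. *)
Lemma isometric_graph_total G T P F : orth_proj ip T P ->
  closed_graph G -> isometric_graph G -> (forall x y, G x y -> T x) ->
  (forall e, F e -> exists y, G e y) ->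
  (forall y, (forall e, F e -> ip y e = 0) -> forall x, T x -> ip y x = 0) ->
  forall x, T x -> exists y, G x y.
Proof.
move=> pT [G0 Glin Gcl] isoG GT FG totF; have [_ complete] := hilH.
have GB x y x' y' : G x y -> G x' y' -> G (x - x') (y - y').
  by move=> Gxy Gx'y'; have := Glin (-1) _ _ _ _ Gx'y' Gxy; rewrite !scaleN1r ![- _ + _]addrC.
pose D x := exists y, G x y.
have sD : subspace D.
  split; first by exists 0.
  by move=> a x x' [y Gxy] [y' Gxy']; exists (a *: y + y'); apply: Glin.
suff clD z : closure ip D z -> D z.
  move=> x Tx; have [d [Dd perp]] := projection_theorem ipH x complete sD clD.
  have Td : T d by case: Dd => y /GT.
  have Txd : T (x - d) := subspaceB (proj_sub pT) Tx Td.
  have /eqP : x - d = 0.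
    apply: (ip_eq0 ipH); apply: totF Txd => e /FG; exact: perp.
  by rewrite subr_eq0 => /eqP ->.
move=> clz.
have approx n : exists p : H * H, G p.1 p.2 /\ sqnorm ip (z - p.1) < n.+1%:R^-1.
  have [|x [[y Gxy] ltx]] := clz n.+1%:R^-1; first by rewrite invr_gt0 ltr0Sn.
  by exists (x, y).
have [u uP] := boolp.choice approx.
have [|y yP] := @complete_rate _ _ ip (fun n => (u n).2) complete.
  move=> m n; have [[Gm ltm] [Gn ltn]] := (uP m, uP n).
  have GBmn := GB _ _ _ _ Gm Gn.
  rewrite /sqnorm -(isoG _ _ _ _ GBmn GBmn) -/(sqnorm ip _).
  have -> : (u m).1 - (u n).1 = - (z - (u m).1) + (z - (u n).1).
    by rewrite opprB addrA subrK.
  apply: le_trans (sqnormD ipH _ _) _; rewrite (sqnormN ipH).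
  by rewrite -mulrDr ler_pM2l ?ltr0Sn // lerD // ltW.
exists y; apply: Gcl => eps eps_gt0.
have [N1 lt1] := inv_succ_lt eps_gt0; have [N2 lt2] := yP _ eps_gt0.
pose n := maxn N1 N2; exists (u n).1, (u n).2; have [Gn ltn] := uP n.
split=> //; split; first exact: lt_trans ltn (lt1 n (leq_maxl _ _)).
by rewrite (sqnormB ipH); apply: lt2 (leq_maxr _ _).
Qed.

(* The graph of the isometry is the smallest closed subspace of [H * H] containing the
   pairs of corresponding basis vectors, so each of its properties follows by exhibiting
   a closed subspace with that property. *)
Lemma same_hdim_isometry S PS T PT : orth_proj ip S PS -> orth_proj ip T PT ->
  same_hdim ip S T ->
  exists W, [/\ (forall x, T x -> S (W x)),
    (forall x y, T x -> T y -> ip (W x) (W y) = ip x y) &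
    (forall z, S z -> exists2 x, T x & W x = z)].
Proof.
move=> pS pT [E [F [[orthE clE totE] [orthF clF totF] [f [EF injf ontof]]]]].
have ES e : E e -> S e by move/clE/(proj_closed ipH pS).
have FT e : F e -> T e by move/clF/(proj_closed ipH pT).
pose G x y := forall K, closed_graph K -> (forall e, E e -> K (f e) e) -> K x y.
have Gf e : E e -> G (f e) e by move=> Ee K _; apply.
have clG : closed_graph G.
  split=> [K [] //|a x y x' y' Gxy Gxy' K clK Kf|x y approx K clK Kf].
    by have [_ + _] := clK; apply; [apply: Gxy | apply: Gxy'].
  have [_ _] := clK; apply=> eps /approx [x' [y' [Gxy ?]]].
  by exists x', y'; split=> //; apply: Gxy.
have GT x y : G x y -> T x /\ S y.
  move=> Gxy; apply: (Gxy (fun x y => T x /\ S y)) => [|e Ee]; last first.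
    by split; [apply/FT/EF | apply: ES].
  split=> [|a x1 y1 x2 y2 [Tx1 Sy1] [Tx2 Sy2]|x1 y1 approx].
  - by split; [case: (proj_sub pT) | case: (proj_sub pS)].
  - by case: (proj_sub pT) (proj_sub pS) => _ linT [_ linS]; split; auto.
  split; [apply: (proj_closed ipH pT) | apply: (proj_closed ipH pS)].
    by move=> eps /approx [x' [y' [[? _] [? _]]]]; exists x'.
  by move=> eps /approx [x' [y' [[_ ?] [_ ?]]]]; exists y'.
have closed_ip a b : closed_graph (fun x y => ip x a = ip y b).
  split=> [|c x y x' y' xy xy'|x y]; first by rewrite !(ip0l ipH).
    by rewrite !(ipDl ipH) !(ipZl ipH) xy xy'.
  exact: (ip_closed ipH).
(* Isometry in two rounds: first against basis pairs, where injectivity of [f] matters, then against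
   arbitrary pairs of [G]. *)
have isoGf x y e : G x y -> E e -> ip x (f e) = ip y e.
  move=> Gxy Ee; apply: (Gxy _ (closed_ip (f e) e)) => e' Ee'.
  rewrite (orthF _ _ (EF _ Ee') (EF _ Ee)) (orthE _ _ Ee' Ee).
  have [->|neq] := eqVneq e' e; first by rewrite eqxx.
  by case: eqP => // /(injf _ _ Ee' Ee) eqe; rewrite eqe eqxx in neq.
have isoG : isometric_graph G.
  move=> x y x' y' Gxy Gxy'; apply: (Gxy _ (closed_ip x' y')) => e Ee.
  by rewrite (ipC ipH) (isoGf _ _ _ Gxy' Ee) -(ipC ipH).
have domG := isometric_graph_total pT clG isoG (fun x y Gxy => proj1 (GT x y Gxy)).
have ranG := isometric_graph_total pS (closed_graph_flip clG).
(* Off [T] nothing is required of the value, and [0] is taken. *)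
have [|W WP] := @boolp.choice H H (fun x y => T x -> G x y).
  move=> x; have [Tx|nTx] := boolp.EM (T x); last by exists 0.
  have [|//|y Gxy] := domG F _ _ x Tx; last by exists y.
  by move=> e /ontof [e' Ee' <-]; exists e'; apply: Gf.
exists W; split.
- by move=> x Tx; have [] := GT _ _ (WP x Tx).
- by move=> x y Tx Ty; rewrite -(isoG _ _ _ _ (WP x Tx) (WP y Ty)).
move=> z Sz; have [||||x Gxz] := ranG E _ _ _ _ z Sz => //.
- by move=> x y x' y' Gyx Gyx'; rewrite (isoG _ _ _ _ Gyx Gyx').
- by move=> x y /GT [].
- by move=> e Ee; exists (f e); apply: Gf.
have [Tx _] := GT _ _ Gxz; exists x => //.
(* The pairs [(x, z)] and [(x, W x)] differ by [(0, z - W x)]; isometry makes the second entry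
   vanish with the first. *)
have [_ Glin _] := clG.
have Gd := Glin (-1) _ _ _ _ (WP x Tx) Gxz.
apply/eqP; rewrite -subr_eq0 -oppr_eq0 opprB addrC -scaleN1r; apply/eqP/(ip_eq0 ipH).
by rewrite -(isoG _ _ _ _ Gd Gd) scaleN1r addNr (ip0l ipH).
Qed.

(** Zorn gives a maximal orthonormal subset of [S]. If [y] is orthogonal to it and [P y] is nonzero,
    the normalized [P y] could be added. *)
Lemma onb_exists S P : orth_proj ip S P -> exists E, onb_of ip S E.
Proof.
move=> pS.
pose good (E : classical_sets.set H) := orthonormal ip E /\ forall e, E e -> S e.
have [|E [[orthE ES] maxE]] := @classical_sets.Zorn_bigcup H good.
  move=> C Cgood totC; split=> [e e'|e] [A CA Ae]; last by case: (Cgood _ CA) => _; apply.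
  move=> [B CB Be']; have [AB|BA] := totC A B CA CB.
    by have [+ _] := Cgood _ CB; apply=> //; apply: AB.
  by have [+ _] := Cgood _ CA; apply=> //; apply: BA.
exists E; split=> // [e Ee eps eps_gt0|y yE x Sx].
  by exists e; split; [exact: ES | rewrite subrr /sqnorm (ip0l ipH)].
suff Py : P y = 0 by apply: (proj_eq0_ip ipH pS).
apply/eqP/negPn/negP => Py_neq0.
have n_gt0 : 0 < sqnorm ip (P y).
  rewrite lt_neqAle sqnorm_ge0 // andbT.
  by apply: contra Py_neq0 => /eqP/esym/(sqnorm_eq0 ipH) ->.
pose c := (Num.sqrt (sqnorm ip (P y)))^-1.
pose v := c%:C *: P y.
have vE e : E e -> ip v e = 0.
  by move=> Ee; rewrite (ipZl ipH) (proj_ip ipH pS) ?yE ?mulr0 //; apply: ES.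
have vv : ip v v = 1.
  rewrite (ipxxE ipH) (sqnormZ ipH) /sqmod /= expr0n addr0 /c exprVn.
  by rewrite sqr_sqrtr ?ltW // mulVf ?gt_eqF.
have Sv : S v by apply: subspaceZ (proj_sub pS) _; apply: (proj_in pS).
have nEv : ~ E v.
  by move=> /vE; rewrite vv => /eqP; rewrite oner_eq0.
apply: (maxE (fun e => E e \/ e = v)); first split.
- by move=> e Ee; left.
- by move=> sub; apply: nEv; apply: sub; right.
split=> [e e'|e [/ES //|-> //]].
have neq u : E u -> (u == v) = false by move=> Eu; apply/eqP => uv; apply: nEv; rewrite -uv.
move=> [Ee|->] [Ee'|->]; first exact: orthE.
- by rewrite neq // (ip_sym0 ipH) // vE.
- by rewrite eq_sym neq // vE.
by rewrite eqxx.
Qed.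

Lemma onb_of_image S E V : unitary ip V -> onb_of ip S E ->
  onb_of ip (fun y => exists2 x, S x & V x = y) (fun y => exists2 e, E e & V e = y).
Proof.
move=> uV [orthE clE totE]; have [Vi [uVi VK ViK]] := unitary_inverse ipH uV.
split=> [_ _ [e Ee <-] [e' Ee' <-]|_ [e Ee <-] eps eps_gt0|y yE _ [x Sx <-]].
- by rewrite unitary_ip // orthE // (can_eq VK).
- have [x [Sx ltx]] := clE e Ee eps eps_gt0.
  exists (V x); split; first by exists x.
  have -> : V e - V x = V (e - x).
    by have := unitaryD (e - x) x uV; rewrite subrK => ->; rewrite addrK.
  by rewrite /sqnorm unitary_ip.
rewrite -[y]ViK unitary_ip //; apply: totE Sx => e Ee.
by rewrite -(unitary_ip _ _ uV) ViK; apply: yE; exists e.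
Qed.

Lemma same_hdim_image S P V : orth_proj ip S P -> unitary ip V ->
  same_hdim ip (fun y => exists2 x, S x & V x = y) S.
Proof.
move=> pS uV; have [E onbE] := onb_exists pS.
have [Vi [uVi VK ViK]] := unitary_inverse ipH uV.
exists (fun y => exists2 e, E e & V e = y), E; split=> //; first exact: onb_of_image.
exists Vi; split.
- by move=> _ [e Ee <-]; rewrite VK.
- by move=> x y _ _ /(can_inj ViK).
by move=> e Ee; exists (V e); [exists e | rewrite VK].
Qed.

End HilbertDimension.

(** * Overlapping factorizations *)

Section OverlappingFactorization.
Variables (R : realType) (H : lmodType R[i]) (ip : H -> H -> R[i]).
Hypothesis hilH : hilbert_space ip.
Variables (HL HC HR : H -> Prop) (PL PC PR : H -> H).
Hypotheses (pL : orth_proj ip HL PL) (pC : orth_proj ip HC PC)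
  (pR : orth_proj ip HR PR).
Hypotheses (oLC : orth ip HL HC) (oLR : orth ip HL HR) (oCR : orth ip HC HR).
Hypothesis dec : forall x, x = PL x + PC x + PR x.

Let ipH : inner_product ip. Proof. by case: hilH. Qed.

Lemma ssum_proj S PS T PT : orth_proj ip S PS -> orth_proj ip T PT ->
  orth ip S T -> orth_proj ip (ssum S T) (fun x => PS x + PT x).
Proof.
move=> pS pT oST; have [S0 linS] := proj_sub pS; have [T0 linT] := proj_sub pT.
split; [split|split].
- by exists 0, 0; rewrite addr0.
- move=> a _ _ [x [y [Sx [Ty ->]]]] [x' [y' [Sx' [Ty' ->]]]].
  exists (a *: x + x'), (a *: y + y'); split; first exact: linS.
  by split; [exact: linT | rewrite scalerDr addrACA].
- by exists (PS x), (PT x); split; [apply: (proj_in pS) | split; [apply: (proj_in pT) |]].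
move=> _ [s [t [Ss [Tt ->]]]].
rewrite (ipBl ipH) ip_orthD //; first last.
- by apply: (ip_sym0 ipH); apply: oST => //; apply: (proj_in pT).
- by apply: oST => //; apply: (proj_in pS).
by rewrite (proj_ip ipH pS) // (proj_ip ipH pT) // (ipDr ipH) subrr.
Qed.

Let HLC := ssum HL HC.
Let HCR := ssum HC HR.
Let PLC x := PL x + PC x.
Let PCR x := PC x + PR x.

Lemma projLC : orth_proj ip HLC PLC. Proof. exact: ssum_proj. Qed.
Lemma projCR : orth_proj ip HCR PCR. Proof. exact: ssum_proj. Qed.

Let inL x : HL (PL x) := proj_in pL x.
Let inC x : HC (PC x) := proj_in pC x.
Let inR x : HR (PR x) := proj_in pR x.

Lemma components l c r : HL l -> HC c -> HR r ->
  [/\ PL (l + c + r) = l, PC (l + c + r) = c & PR (l + c + r) = r].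
Proof.
move=> Hl Hc Hr; have sym x y := @ip_sym0 _ _ _ ipH x y.
split.
- apply: (proj_unique ipH pL) => // z Hz.
  by rewrite !(ipDl ipH) (sym _ _ (oLC Hz Hc)) (sym _ _ (oLR Hz Hr)) !addr0.
- apply: (proj_unique ipH pC) => // z Hz.
  by rewrite !(ipDl ipH) (oLC Hl Hz) (sym _ _ (oCR Hz Hr)) addr0 add0r.
apply: (proj_unique ipH pR) => // z Hz.
by rewrite !(ipDl ipH) (oLR Hl Hz) (oCR Hc Hz) !add0r.
Qed.

Let L0 : HL 0. Proof. by case: (proj_sub pL). Qed.
Let C0 : HC 0. Proof. by case: (proj_sub pC). Qed.
Let R0 : HR 0. Proof. by case: (proj_sub pR). Qed.

Lemma componentsL l : HL l -> [/\ PL l = l, PC l = 0 & PR l = 0].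
Proof. by move=> Hl; have := components Hl C0 R0; rewrite !addr0. Qed.

Lemma componentsR r : HR r -> [/\ PL r = 0, PC r = 0 & PR r = r].
Proof. by move=> Hr; have := components L0 C0 Hr; rewrite !add0r. Qed.

Lemma PLC_eq0 x : PLC x = 0 -> HR x.
Proof. by rewrite {2}(dec x) -/(PLC x) => ->; rewrite add0r. Qed.

Lemma PCR_eq0 x : PCR x = 0 -> HL x.
Proof. by rewrite {2}(dec x) -addrA -/(PCR x) => ->; rewrite addr0. Qed.

Lemma PR_eq0 x : PR x = 0 <-> HLC x.
Proof.
split=> [x0|[l [c [Hl [Hc ->]]]]]; last first.
  by have [_ _] := components Hl Hc R0; rewrite addr0.
by rewrite (dec x) x0 addr0; exists (PL x), (PC x).
Qed.

Lemma PL_eq0 x : PL x = 0 <-> HCR x.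
Proof.
split=> [x0|[c [r [Hc [Hr ->]]]]]; last first.
  by have [+ _ _] := components L0 Hc Hr; rewrite add0r.
by rewrite (dec x) x0 add0r; exists (PC x), (PR x).
Qed.

Lemma ip_LC_R x y : HLC x -> HR y -> ip x y = 0.
Proof. by move=> [l [c [Hl [Hc ->]]]] Hy; rewrite (ipDl ipH) oLR // oCR // addr0. Qed.

Lemma ip_L_CR x y : HL x -> HCR y -> ip x y = 0.
Proof. by move=> Hx [c [r [Hc [Hr ->]]]]; rewrite (ipDr ipH) oLC // oLR // addr0. Qed.

Lemma subPLC x : x - PLC x = PR x.
Proof. by rewrite {1}(dec x) addrC addKr. Qed.

Lemma subPCR x : x - PCR x = PL x.
Proof. by rewrite {1}(dec x) -(addrA (PL x)) addrK. Qed.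

Lemma extLCE V x : V (PLC x) + PR x = extend PLC V x.
Proof. by rewrite /extend subPLC. Qed.

Lemma extCRE V x : PL x + V (PCR x) = extend PCR V x.
Proof. by rewrite /extend subPCR addrC. Qed.

Variable U : H -> H.
Hypothesis uU : unitary ip U.

(** The redex keeps the body convertible with [factorization] in the theorem, so the lemmas apply
    there directly. *)
Definition overlapping ULC UCR : Prop :=
  [/\ unitary_on ip HLC ULC, unitary_on ip HCR UCR &
      forall x, U x = (fun y => ULC (PLC y) + PR y) (PL x + UCR (PCR x))].

(* The same factorization in terms of [X = U_LC (+) 1] and [Y = 1 (+) U_CR]. *)
Definition splits X Y : Prop :=
  [/\ unitary ip X, unitary ip Y,
      (forall x, HR x -> X x = x), (forall x, HL x -> Y x = x) &
      forall x, U x = X (Y x)].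

Lemma overlapping_splits ULC UCR : overlapping ULC UCR ->
  splits (extend PLC ULC) (extend PCR UCR).
Proof.
move=> [uLC uCR UE]; split.
- exact: (extend_unitary ipH projLC).
- exact: (extend_unitary ipH projCR).
- move=> x Hx; apply: (extend_fix projLC) => //.
  by rewrite /PLC; have [-> -> _] := componentsR Hx; rewrite addr0.
- move=> x Hx; apply: (extend_fix projCR) => //.
  by rewrite /PCR; have [_ -> ->] := componentsL Hx; rewrite addr0.
by move=> x; rewrite UE extLCE extCRE.
Qed.

(** [X] and [Y] serve as the two factors themselves, since [unitary_on] sees only their
    restrictions. *)
Lemma splits_overlapping X Y : splits X Y -> overlapping X Y.
Proof.
move=> [uX uY fixX fixY UE].
have fX x : PLC x = 0 -> X x = x by move/PLC_eq0/fixX.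
have fY x : PCR x = 0 -> Y x = x by move/PCR_eq0/fixY.
split; first exact: (restrict_unitary ipH projLC).
  exact: (restrict_unitary ipH projCR).
move=> x; rewrite extLCE extCRE (extend_restrict ipH projCR) //.
by rewrite (extend_restrict ipH projLC).
Qed.

Lemma eq_overlapping ULC UCR V W : overlapping ULC UCR ->
  (forall x, HLC x -> V x = ULC x) -> (forall x, HCR x -> W x = UCR x) ->
  overlapping V W.
Proof.
move=> [uLC uCR UE] VE WE.
split; first exact: (eq_unitary_on ipH (proj_sub projLC) uLC).
  exact: (eq_unitary_on ipH (proj_sub projCR) uCR).
move=> x; rewrite UE /= WE ?VE //.
  exact: (proj_in projLC).
exact: (proj_in projCR).
Qed.

Let cond_zero := forall x, PR (U (PL x)) = 0.
Let A x := PLC (U (PCR x)).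

Lemma cond_zeroP : cond_zero -> forall l, HL l -> HLC (U l).
Proof. by move=> U0 l Hl; apply/PR_eq0; rewrite -(proj_id ipH pL Hl). Qed.

Lemma splits_left X : unitary ip X -> (forall x, HR x -> X x = x) ->
  (forall x, HL x -> X x = U x) -> exists Y, splits X Y.
Proof.
move=> uX fixX XU; have [Xi [uXi XK XiK]] := unitary_inverse ipH uX.
exists (Xi \o U); split=> //; first exact: unitary_comp.
- by move=> x Hx /=; rewrite -XU.
by move=> x; rewrite /= XiK.
Qed.

(** * Necessity of the two conditions *)

Lemma splits_LC X Y : splits X Y -> forall x, HLC x -> HLC (X x).
Proof.
move=> [uX _ fixX _ _]; apply: (unitary_preserves ipH projLC) => // x.
by move/PLC_eq0/fixX.
Qed.

Lemma splits_cond_zero X Y : splits X Y -> cond_zero.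
Proof.
move=> XY x; have [uX _ _ fixY UE] := XY.
rewrite UE fixY //; apply/PR_eq0; apply: (splits_LC XY).
by exists (PL x), 0; rewrite addr0.
Qed.

(** [Y] maps [HCR] onto itself, so [Y (PCR x)] is a vector of [HC] plus one of [HR]. The latter is
    fixed by [X] and killed by [PLC], leaving [X (PC (Y (PCR x)))], in which the [PC] part runs over
    all of [HC]. *)
Lemma splits_range X Y : splits X Y ->
  range A = (fun y => exists2 x, HC x & X x = y).
Proof.
move=> XY; have [uX uY fixX fixY UE] := XY.
have [Yi [uYi YK YiK]] := unitary_inverse ipH uY.
have fY x : PCR x = 0 -> Y x = x by move/PCR_eq0/fixY.
have fYi x : PCR x = 0 -> Yi x = x by move=> /fY Yx; rewrite -{1}Yx YK.
have CRC c : HC c -> HCR c by move=> Hc; exists c, 0; rewrite addr0.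
have LCC c : HC c -> HLC c by move=> Hc; exists 0, c; rewrite add0r.
have AE x : A x = X (PC (Y (PCR x))).
  rewrite /A UE; have /PL_eq0 yL : HCR (Y (PCR x)).
    by apply: (unitary_preserves ipH projCR uY fY); apply: (proj_in projCR).
  move: (Y _) yL => y yL; rewrite {1}(dec y) yL add0r (unitaryD _ _ uX) (fixX _ (inR y)).
  rewrite (projD ipH projLC) (proj_id ipH projLC); last by apply: (splits_LC XY); auto.
  by rewrite /PLC; have [-> -> _] := componentsR (inR y); rewrite !addr0.
apply: boolp.funext => z; apply: boolp.propext; split=> [[x <-]|[c Hc <-]].
  by exists (PC (Y (PCR x))); rewrite ?AE.
exists (Yi c); rewrite AE (proj_id ipH projCR).
  by rewrite YiK (proj_id ipH pC).
by apply: (unitary_preserves ipH projCR uYi fYi); auto.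
Qed.

Lemma range_proj S P : orth_proj ip S P -> range P = S.
Proof.
move=> pS; apply: boolp.funext => x; apply: boolp.propext; split=> [[y <-]|Sx].
  exact: (proj_in pS).
by exists x; apply: (proj_id ipH pS).
Qed.

Lemma splits_rank X Y : splits X Y -> same_rank ip A PC.
Proof.
move=> XY; rewrite /same_rank (splits_range XY) (range_proj pC).
by case: XY => uX _ _ _ _; apply: (same_hdim_image hilH pC).
Qed.

(* [A] maps onto the orthogonal complement of [U HL] in [HLC]. *)
Lemma compression_decomposition : cond_zero ->
  forall x, PLC (U x) = U (PL x) + A x.
Proof.
move=> U0 x; rewrite {1}(dec x) -addrA (unitaryD _ _ uU) (projD ipH projLC).
by rewrite (proj_id ipH projLC) //; apply: cond_zeroP.
Qed.

Lemma ip_UL_range : cond_zero ->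
  forall l x, HL l -> ip (U l) (A x) = 0.
Proof.
move=> U0 l x Hl; rewrite (ipC ipH) (proj_ip ipH projLC); last exact: cond_zeroP.
rewrite -(ipC ipH) unitary_ip //; apply: ip_L_CR => //; exact: (proj_in projCR).
Qed.

(** Makes the range of [A] eligible for [same_hdim_isometry]. The remainder is
    [PR z + U (PL (Ui z))], both terms orthogonal to that range. *)
Lemma range_compression_proj Ui : cond_zero -> cancel Ui U ->
  orth_proj ip (range A) (fun z => A (Ui z)).
Proof.
move=> U0 UiK; have [linU _ _ _] := uU.
split=> [|z]; split.
- have [pL0 pC0 pR0] := componentsL L0.
  by exists 0; rewrite /A /PLC /PCR pC0 pR0 addr0 (unitary0 uU) pL0 pC0 addr0.
- move=> a _ _ [x <-] [y <-]; exists (a *: x + y).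
  rewrite /A (projD ipH projCR) (projZ ipH projCR) linU //.
  by rewrite (projD ipH projLC) (projZ ipH projLC).
- by exists (Ui z).
move=> _ [y <-].
have -> : z - A (Ui z) = PR z + U (PL (Ui z)).
  rewrite {1}(dec z) -/(PLC z) -{1}[z]UiK (compression_decomposition U0).
  by rewrite addrAC addrK addrC.
rewrite (ipDl ipH) ip_UL_range // addr0; apply: (ip_sym0 ipH).
by apply: ip_LC_R => //; apply: (proj_in projLC).
Qed.

(** * Existence of factorizations *)

Lemma rank_splits : cond_zero -> same_rank ip A PC -> exists X Y, splits X Y.
Proof.
move=> U0; rewrite /same_rank (range_proj pC) => rk.
have [Ui [uUi UK UiK]] := unitary_inverse ipH uU.
have pK := range_compression_proj U0 UiK.
have [W [WK isoW ontoW]] := same_hdim_isometry hilH pK pC rk.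
have K_LC y : range A y -> HLC y by move=> [x <-]; apply: (proj_in projLC).
have W0 : W 0 = 0.
  by apply: (ip_eq0 ipH); rewrite isoW // (ip0l ipH).
(* [U] on [HL], the isometry [W] from [HC] onto the range of [A], and the identity on [HR]: three
   pieces with mutually orthogonal images. *)
pose X x := U (PL x) + W (PC x) + PR x.
have XLC x : HLC (U (PL x) + W (PC x)).
  apply: subspaceD; first exact: (proj_sub projLC); first exact: cond_zeroP.
  by apply: K_LC; apply: WK.
have UW x y : ip (U (PL x)) (W (PC y)) = 0.
  by have [v <-] := WK _ (inC y); apply: ip_UL_range.
suff uX : unitary ip X.
  have [||Y XY] := @splits_left X uX; last by exists X, Y.
    by move=> x /componentsR [xL xC xR]; rewrite /X xL xC xR (unitary0 uU) W0 !add0r.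
  by move=> x /componentsL [xL xC xR]; rewrite /X xL xC xR W0 !addr0.
apply: (isometry_onto_unitary ipH) => [x y|z].
  have sym u v := @ip_sym0 _ _ _ ipH u v.
  have XR u v : ip (U (PL u) + W (PC u)) (PR v) = 0 by apply: ip_LC_R.
  have LCR u v : ip (PL u + PC u) (PR v) = 0.
    by apply: ip_LC_R => //; exact: (proj_in projLC).
  rewrite /X (ip_orthD ipH (XR x y) (sym _ _ (XR y x))).
  rewrite (ip_orthD ipH (UW x y) (sym _ _ (UW y x))) (unitary_ip _ _ uU) isoW //.
  rewrite -(ip_orthD ipH (oLC (inL x) (inC y)) (sym _ _ (oLC (inL y) (inC x)))).
  by rewrite -(ip_orthD ipH (LCR x y) (sym _ _ (LCR y x))) -!dec.
(* Since [PLC z = U (PL (Ui z)) + A (Ui z)], a preimage of [z] needs a [c] in [HC] with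
   [W c = A (Ui z)]. *)
have [c Hc Wc] := ontoW (A (Ui z)) (ex_intro _ _ erefl).
exists (PL (Ui z) + c + PR z); rewrite /X.
have [-> -> ->] := components (inL (Ui z)) Hc (inR z).
by rewrite Wc -(compression_decomposition U0) UiK -dec.
Qed.

Lemma fin_dim_splits : fin_dim HL \/ fin_dim HR -> cond_zero ->
  exists X Y, splits X Y.
Proof.
move=> fd U0; have [Ui [uUi UK UiK]] := unitary_inverse ipH uU.
case: fd => [] [s [sH span]].
  have [X [uX XU fixX]] := finite_unitary_extension ipH s uU.
  have [||Y XY] := @splits_left X uX; last by exists X, Y.
    move=> r Hr; apply: fixX => v /sH Hv.
    by split; apply: (ip_sym0 ipH); [apply: oLR | apply: ip_LC_R => //; apply: cond_zeroP].
  move=> x /span [c ->]; rewrite (unitary_sum _ _ _ uX) (unitary_sum _ _ _ uU).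
  by apply: eq_big_seq => v /XU ->.
(* For finite-dimensional [HR], [Z] agrees with the inverse of [U] on [HR] and fixes [HL]. Then
   [X = U \o Z] fixes [HR], and [Y] is the inverse of [Z]. *)
have [Z [uZ ZU fixZ]] := finite_unitary_extension ipH s uUi.
have [Zi [uZi ZK ZiK]] := unitary_inverse ipH uZ.
exists (U \o Z), Zi; split=> //; first exact: unitary_comp.
- move=> x /span [c ->] /=; rewrite (unitary_sum _ _ _ uZ).
  rewrite (_ : \sum_(v <- s) c v *: Z v = \sum_(v <- s) c v *: Ui v); last first.
    by apply: eq_big_seq => v /ZU ->.
  by rewrite -(unitary_sum _ _ _ uUi) UiK.
- move=> x Hx; rewrite -{1}(fixZ x) ?ZK // => v /sH Hv; split; first exact: oLR.
  (* Applying [U] to both arguments compares [U x], in [HLC], with [v], in [HR]. *)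
  by rewrite -(unitary_ip _ _ uU) UiK; apply: ip_LC_R => //; apply: cond_zeroP.
by move=> x /=; rewrite ZiK.
Qed.

(** * Uniqueness up to a unitary on [HC] *)

Lemma overlapping_unique ULC UCR ULC' UCR' :
  overlapping ULC UCR -> overlapping ULC' UCR' ->
  exists UC UCd, [/\ unitary_on ip HC UC, adjoint_on ip HC UC UCd,
    (forall x, HLC x -> ULC' x = ULC (PL x + UC (PC x))) &
    (forall x, HCR x -> UCR' x = UCd (PC (UCR x)) + PR (UCR x))].
Proof.
move=> ov ov'; have [uX uY fixX fixY UE] := overlapping_splits ov.
have [uX' uY' fixX' fixY' UE'] := overlapping_splits ov'.
have XE x : HLC x -> extend PLC ULC x = ULC x by apply: (extend_in ipH projLC).
have XE' x : HLC x -> extend PLC ULC' x = ULC' x by apply: (extend_in ipH projLC).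
have YE x : HCR x -> extend PCR UCR x = UCR x by apply: (extend_in ipH projCR).
have YE' x : HCR x -> extend PCR UCR' x = UCR' x by apply: (extend_in ipH projCR).
move: (extend PLC ULC) (extend PLC ULC') (extend PCR UCR) (extend PCR UCR')
  uX uX' uY uY' fixX fixX' fixY fixY' UE UE' XE XE' YE YE'
  => X X' Y Y' uX uX' uY uY' fixX fixX' fixY fixY' UE UE' XE XE' YE YE'.
have [Xi [uXi XK XiK]] := unitary_inverse ipH uX.
have [Xi' [uXi' XK' XiK']] := unitary_inverse ipH uX'.
(* As both products equal [U], [Q] carries [Y'] to [Y] as well. It fixes [HR] because [X] and [X']
   do, and [HL] because [Y] and [Y'] do. *)
pose Q := Xi \o X'; pose Qd := Xi' \o X.
have uQ : unitary ip Q by apply: unitary_comp.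
have uQd : unitary ip Qd by apply: unitary_comp.
have QK : cancel Q Qd by move=> x; rewrite /Q /Qd /= XiK XK'.
have QdK : cancel Qd Q by move=> x; rewrite /Q /Qd /= XiK' XK.
have QY x : Y' x = Qd (Y x) by rewrite /Qd /= -UE UE' XK'.
have QR x : HR x -> Q x = x by move=> Hx; rewrite /Q /= fixX' // -{1}(fixX x) ?XK.
have QdR x : HR x -> Qd x = x by move=> /QR {1}<-.
have QdL x : HL x -> Qd x = x by move=> Hx; rewrite -{1}(fixY x Hx) -QY fixY'.
have QL x : HL x -> Q x = x by move=> /QdL {1}<-.
have fixQ x : PC x = 0 -> Q x = x.
  by move=> xC; rewrite (dec x) xC addr0 (unitaryD _ _ uQ) QL // QR.
have uQC := restrict_unitary ipH pC uQ fixQ.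
have [_ QC _ _] := uQC.
have fixQd x : PC x = 0 -> Qd x = x by move/fixQ => {1}<-.
have [_ QdC _ _] := restrict_unitary ipH pC uQd fixQd.
exists Q, Qd; split=> //.
- split=> // x y _ _; by rewrite -(unitary_ip _ _ uQd) QK.
- move=> x Hx; have /PR_eq0 xR := Hx.
  have Qx : PL x + Q (PC x) = Q x.
    by rewrite -{1}(QL _ (inL x)) -(unitaryD _ _ uQ) {3}(dec x) xR addr0.
  rewrite -XE; last by exists (PL x), (Q (PC x)); split=> //; split=> //; apply: QC.
  by rewrite Qx -XE' // /Q /= XiK.
move=> x Hx; rewrite -YE' // QY -YE //.
have /PL_eq0 yL : HCR (Y x) by rewrite YE //; case: ov => _ [_ + _ _] _; apply.
move: (Y x) yL => y yL; rewrite {1}(dec y) yL add0r (unitaryD _ _ uQd).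
by rewrite (QdR (PR y)).
Qed.

(** Inserts [Q] and its inverse between the two global factors, with [Q] acting as [UC] on [HC] and
    as the identity on [HL] and [HR]. *)
Lemma overlapping_modify ULC UCR UC UCd : overlapping ULC UCR ->
  unitary_on ip HC UC -> adjoint_on ip HC UC UCd ->
  overlapping (fun x => ULC (PL x + UC (PC x)))
              (fun x => UCd (PC (UCR x)) + PR (UCR x)).
Proof.
move=> ov uC [UCdC adj]; have [uX uY fixX fixY UE] := overlapping_splits ov.
have [_ UCC isoC ontoC] := uC.
(* For [y = UC z], the adjoint relation and isometry make [UCd (UC z) - z] orthogonal to itself. *)
have UCdK y : HC y -> UC (UCd y) = y.
  move=> Hy; have [z Hz <-] := ontoC _ Hy; congr UC.
  apply/eqP; rewrite -subr_eq0; apply/eqP/(ip_eq0 ipH).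
  have Hd : HC (UCd (UC z) - z).
    by apply: subspaceB (proj_sub pC) _ _ => //; apply/UCdC/UCC.
  by rewrite (ipBr ipH) -adj ?isoC ?subrr //; apply: UCC.
pose Q := extend PC UC.
have uQ : unitary ip Q := extend_unitary ipH pC uC.
have QE x : Q x = PL x + UC (PC x) + PR x.
  have xC : x - PC x = PL x + PR x by rewrite {1}(dec x) addrAC addrK.
  by rewrite /Q /extend xC addrA [UC _ + _]addrC.
have [Qi [uQi QK QiK]] := unitary_inverse ipH uQ.
have QiE x : Qi x = PL x + UCd (PC x) + PR x.
  rewrite -[RHS]QK; congr Qi; rewrite QE.
  have [-> -> ->] := components (inL x) (UCdC _ (inC x)) (inR x).
  by rewrite UCdK // -dec.
have Qfix x : PC x = 0 -> Q x = x by apply: (extend_fix pC).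
have QR x : HR x -> Q x = x by move=> /componentsR [_ + _]; apply: Qfix.
have QL x : HL x -> Q x = x by move=> /componentsL [_ + _]; apply: Qfix.
apply: (@eq_overlapping (extend PLC ULC \o Q) (Qi \o extend PCR UCR)).
- apply: splits_overlapping; split.
  + exact: unitary_comp.
  + exact: unitary_comp.
  + by move=> x Hx /=; rewrite QR // fixX.
  + by move=> x Hx /=; rewrite fixY // -{1}(QL x) ?QK.
  by move=> x /=; rewrite QiK.
- move=> x /PR_eq0 xR /=; rewrite QE xR addr0 (extend_in ipH projLC) //.
  by exists (PL x), (UC (PC x)); split=> //; split=> //; apply: UCC.
move=> x Hx /=; rewrite (extend_in ipH projCR) // QiE.
have /PL_eq0 -> : HCR (UCR x) by case: ov => _ [_ + _ _] _; apply.
by rewrite add0r.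
Qed.

End OverlappingFactorization.

Theorem theorem2p4 (R : realType) (H : lmodType R[i]) (ip : H -> H -> R[i])
  (hilH : hilbert_space ip)
  (HL HC HR : H -> Prop) (PL PC PR : H -> H)
  (pL : orth_proj ip HL PL) (pC : orth_proj ip HC PC) (pR : orth_proj ip HR PR)
  (oLC : orth ip HL HC) (oLR : orth ip HL HR) (oCR : orth ip HC HR)
  (dec : forall x, x = PL x + PC x + PR x)
  (U : H -> H) (hU : unitary ip U) :
  let HLC := ssum HL HC in
  let HCR := ssum HC HR in
  let PLC := fun x => PL x + PC x in
  let PCR := fun x => PC x + PR x in
  (* U_LC (+) 1_R  and  1_L (+) U_CR *)
  let ext_LC := fun V : H -> H => fun x => V (PLC x) + PR x in
  let ext_CR := fun V : H -> H => fun x => PL x + V (PCR x) in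
  let factorization := fun ULC UCR : H -> H =>
    [/\ unitary_on ip HLC ULC, unitary_on ip HCR UCR &
        forall x, U x = ext_LC ULC (ext_CR UCR x)] in
  let cond_zero := forall x, PR (U (PL x)) = 0 in
  [/\
    (* existence criterion *)
    (exists ULC UCR, factorization ULC UCR) <->
      (cond_zero /\ same_rank ip (fun x => PLC (U (PCR x))) PC),
    (* any two factorizations differ by a unitary U_C on H_C *)
    (forall ULC UCR ULC' UCR', factorization ULC UCR -> factorization ULC' UCR' ->
       exists UC UCd, [/\ unitary_on ip HC UC, adjoint_on ip HC UC UCd,
         (forall x, HLC x -> ULC' x = ULC (PL x + UC (PC x))) &
         (forall x, HCR x -> UCR' x = UCd (PC (UCR x)) + PR (UCR x))]),
    (* every such modification is again a factorization *)
    (forall ULC UCR UC UCd, factorization ULC UCR ->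
       unitary_on ip HC UC -> adjoint_on ip HC UC UCd ->
       factorization (fun x => ULC (PL x + UC (PC x)))
                     (fun x => UCd (PC (UCR x)) + PR (UCR x))) &
    (* finite-dimensional case: rank condition can be dropped *)
    (fin_dim HL \/ fin_dim HR ->
       ((exists ULC UCR, factorization ULC UCR) <-> cond_zero))].
Proof.
move=> HLC HCR PLC PCR ext_LC ext_CR factorization cond_zero.
have toX ULC UCR (f : factorization ULC UCR) :=
  overlapping_splits hilH pL pC pR oLC oLR oCR dec f.
have ofX X Y (XY : splits ip HL HR U X Y) : factorization X Y :=
  splits_overlapping hilH pL pC pR oLC oCR dec XY.
have zero : (exists ULC UCR, factorization ULC UCR) -> cond_zero.
  by move=> [ULC [UCR /toX XY]]; exact: (splits_cond_zero hilH pL pC pR oLC oLR oCR dec XY).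
split.
- split=> [ex|[U0 rk]].
    split; first exact: zero.
    by have [ULC [UCR /toX XY]] := ex; exact: (splits_rank hilH pL pC pR oLC oLR oCR dec XY).
  have [X [Y XY]] := rank_splits hilH pL pC pR oLC oLR oCR dec hU U0 rk.
  by exists X, Y; apply: ofX.
- move=> ULC UCR ULC' UCR'; exact: (overlapping_unique hilH pL pC pR oLC oLR oCR dec).
- move=> ULC UCR UC UCd; exact: (overlapping_modify hilH pL pC pR oLC oLR oCR dec).
move=> fd; split=> // U0.
have [X [Y XY]] := fin_dim_splits hilH pL pC pR oLC oLR oCR dec hU fd U0.
by exists X, Y; apply: ofX.
Qed.
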